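(* Let $\mathfrak{g}_1=\mathbb{R}\ltimes_{A_1}\mathbb{R}^d$ and $\mathfrak{g}_2=\mathbb{R}\ltimes_{A_2}\mathbb{R}^d$ be two isomorphic almost abelian Lie algebras which are not isomorphic to $\mathfrak{h}_3\times\mathbb{R}^{d-2}$, and let $c\in\mathbb{R}$, $c\ne0$, and $P\in\operatorname{GL}(d,\mathbb{R})$ be such that $A_1=cPA_2P^{-1}$, with $c=1$ when $\mathfrak{g}_1$ is nilpotent. (i) If $f:\mathfrak{g}_1\to\mathfrak{g}_2$ is a Lie algebra isomorphism, then there exist $\mu\in\mathbb{R}$, $\mu\ne0$, $v_0\in\mathbb{R}^d$ and $L\in\operatorname{GL}(d,\mathbb{R})$ such that $$f(t,v)=(\mu t,\,Lv+tv_0),\quad(t,v)\in\mathfrak{g}_1,\qquad\text{with } LPA_2=\frac{\mu}{c}A_2LP.$$ Moreover, if $\mathfrak{g}_1$ is not nilpotent, then $\mu=\pm c$. (ii) If $G_1$ and $G_2$ are the simply connected Lie groups with Lie algebras $\mathfrak{g}_1$ and $\mathfrak{g}_2$, respectively, and $F:G_1\to G_2$ is the Lie group isomorphism such that $(dF)_{(0,0)}=f$, with $f$ as in (i), then $F$ has the following form: $$F(t,v)=\left(\mu t,\,Lv+t\,\Phi(\mu tA_2)v_0\right),\quad(t,v)\in G_1.$$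
   Context: A Lie algebra is almost abelian if it has a codimension one abelian ideal. For $A\in\mathfrak{gl}(d,\mathbb{R})$, $\mathbb{R}\ltimes_A\mathbb{R}^d$ denotes the Lie algebra $\mathbb{R}\times\mathbb{R}^d$ with $\mathbb{R}^d$ an abelian ideal and $[(1,0),(0,v)]=(0,Av)$. The corresponding simply connected Lie group is $\mathbb{R}\times\mathbb{R}^d$ with product $(t,v)(s,w)=(t+s,v+e^{tA}w)$; its Lie algebra is identified with the tangent space $\mathbb{R}\times\mathbb{R}^d$ at $(0,0)$. $\mathfrak{h}_3$ is the $3$-dimensional Heisenberg Lie algebra. $\Phi(x)=\sum_{k=0}^\infty\frac{x^k}{(k+1)!}$, applied to matrices via its power series.
   Formalization: The Lie algebra g_1 is additionally assumed to be non-abelian: for A_1 = A_2 = 0 and d ≥ 1, a linear automorphism of R^{d+1} not preserving R^d contradicts (i). *)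

(* Defs.v *)
From HB Require Import structures.
From mathcomp Require Export all_boot all_order all_algebra.
From mathcomp Require Export all_classical all_reals all_analysis.
From mathcomp Require Import ring.
Set Implicit Arguments.
Unset Strict Implicit.
Unset Printing Implicit Defensive.
Import Order.TTheory GRing.Theory Num.Theory.
Import numFieldNormedType.Exports.
Local Open Scope ring_scope.

Record lieAlgebra (K : fieldType) := LieAlgebra {
  lie_sort :> vectType K;
  lbr : lie_sort -> lie_sort -> lie_sort;
  lbr_linl : forall y, linear (lbr^~ y);
  lbr_linr : forall x, linear (lbr x);
  lbrxx : forall x, lbr x x = 0;
  lbr_jacobi : forall x y z,
    lbr x (lbr y z) + lbr y (lbr z x) + lbr z (lbr x y) = 0
}.
Arguments lbr {K l} x y.

Section LieTheory.
Variable K : fieldType.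
Implicit Types g h : lieAlgebra K.

Definition lie_iso g h (f : g -> h) : Prop :=
  [/\ linear f, bijective f & forall x y, f (lbr x y) = lbr (f x) (f y)].

Definition lie_isomorphic g h : Prop := exists f : g -> h, lie_iso f.

Definition lie_ideal g (I : {vspace g}) : Prop :=
  forall x y, y \in I -> lbr x y \in I.

Definition lie_abelian_on g (U : {vspace g}) : Prop :=
  forall x y, x \in U -> y \in U -> lbr x y = 0.

Definition lie_abelian g : Prop := forall x y : g, lbr x y = 0.

Definition almost_abelian g : Prop :=
  exists I : {vspace g},
    [/\ lie_ideal I, lie_abelian_on I & (\dim I).+1 = \dim {:g}].

(* [U, V], the span of all brackets; by bilinearity bases of U and V suffice. *)
Definition lie_comm g (U V : {vspace g}) : {vspace g} :=
  <<[seq lbr x y | x <- vbasis U, y <- vbasis V]>>%VS.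

Fixpoint lower_central g (n : nat) : {vspace g} :=
  if n is n'.+1 then lie_comm fullv (lower_central g n') else fullv.

Definition lie_nilpotent g : Prop := exists n, lower_central g n = 0%VS.

Section AbelianLie.
Variable V : vectType K.

Definition ab_lbr (x y : V) : V := 0.

Fact ab_lbr_linl y : linear (ab_lbr^~ y).
Proof. by move=> a u v; rewrite /ab_lbr scaler0 addr0. Qed.
Fact ab_lbr_linr x : linear (ab_lbr x).
Proof. by move=> a u v; rewrite /ab_lbr scaler0 addr0. Qed.
Fact ab_lbrxx x : ab_lbr x x = 0. Proof. by []. Qed.
Fact ab_lbr_jacobi x y z :
  ab_lbr x (ab_lbr y z) + ab_lbr y (ab_lbr z x) + ab_lbr z (ab_lbr x y) = 0.
Proof. by rewrite /ab_lbr !addr0. Qed.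

Definition abelian_lie : lieAlgebra K :=
  LieAlgebra ab_lbr_linl ab_lbr_linr ab_lbrxx ab_lbr_jacobi.
End AbelianLie.

Section ProductLie.
Variables g h : lieAlgebra K.

Definition prod_lbr (x y : g * h) : g * h := (lbr x.1 y.1, lbr x.2 y.2).

Fact prod_lbr_linl y : linear (prod_lbr^~ y).
Proof.
by move=> a u v; apply: injective_projections; rewrite /= lbr_linl.
Qed.
Fact prod_lbr_linr x : linear (prod_lbr x).
Proof.
by move=> a u v; apply: injective_projections; rewrite /= lbr_linr.
Qed.
Fact prod_lbrxx x : prod_lbr x x = 0.
Proof. by rewrite /prod_lbr !lbrxx. Qed.
Fact prod_lbr_jacobi x y z :
  prod_lbr x (prod_lbr y z) + prod_lbr y (prod_lbr z x)
    + prod_lbr z (prod_lbr x y) = 0.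
Proof.
rewrite /prod_lbr /=.
transitivity ((lbr x.1 (lbr y.1 z.1) + lbr y.1 (lbr z.1 x.1)
                 + lbr z.1 (lbr x.1 y.1),
               lbr x.2 (lbr y.2 z.2) + lbr y.2 (lbr z.2 x.2)
                 + lbr z.2 (lbr x.2 y.2)) : g * h) => //.
by rewrite !lbr_jacobi.
Qed.

Definition prod_lie : lieAlgebra K :=
  LieAlgebra prod_lbr_linl prod_lbr_linr prod_lbrxx prod_lbr_jacobi.
End ProductLie.

(* R^3 with basis e_0, e_1, e_2, whose only nonzero bracket (up to sign) of
   basis vectors is [e_0, e_1] = e_2. *)
Section Heisenberg.

Definition h3_lbr (x y : 'cV[K]_3) : 'cV[K]_3 :=
  (x 0 0 * y 1 0 - x 1 0 * y 0 0) *: delta_mx ord_max 0.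

Fact h3_lbr_linl y : linear (h3_lbr^~ y).
Proof.
move=> a u v; rewrite /h3_lbr scalerA -scalerDl !mxE; congr (_ *: _).
by ring.
Qed.
Fact h3_lbr_linr x : linear (h3_lbr x).
Proof.
move=> a u v; rewrite /h3_lbr scalerA -scalerDl !mxE; congr (_ *: _).
by ring.
Qed.
Fact h3_lbrxx x : h3_lbr x x = 0.
Proof. by rewrite /h3_lbr mulrC subrr scale0r. Qed.
Fact h3_lbr_jacobi x y z :
  h3_lbr x (h3_lbr y z) + h3_lbr y (h3_lbr z x) + h3_lbr z (h3_lbr x y) = 0.
Proof. by rewrite /h3_lbr !mxE /= !mulr0 !subrr !scale0r !addr0. Qed.

Definition h3 : lieAlgebra K :=
  LieAlgebra h3_lbr_linl h3_lbr_linr h3_lbrxx h3_lbr_jacobi.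
End Heisenberg.

(* R |x_A R^d : the bilinear alternating extension of [(1,0),(0,v)] = (0,Av)
   that vanishes on R^d. *)
Section SemidirectLie.
Variables (d : nat) (A : 'M[K]_d).

Definition sd_lbr (x y : K^o * 'cV[K]_d) : K^o * 'cV[K]_d :=
  (0, (x.1 : K) *: (A *m y.2) - (y.1 : K) *: (A *m x.2)).

Fact sd_lbr_linl y : linear (sd_lbr^~ y).
Proof.
move=> a [t u] [s v]; rewrite /sd_lbr /=.
rewrite [RHS](_ : _ = (a *: (0 : K^o) + 0,
  a *: (t *: (A *m y.2) - y.1 *: (A *m u))
    + (s *: (A *m y.2) - y.1 *: (A *m v)))) //.
congr (_, _); first by rewrite scaler0 addr0.
rewrite mulmxDr -scalemxAr scalerDl scalerDr scalerBr opprD !scalerA addrACA.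
by rewrite (mulrC y.1).
Qed.
Fact sd_lbrC x y : sd_lbr x y = - sd_lbr y x.
Proof.
rewrite /sd_lbr [RHS](_ : _ = (- 0, - (y.1 *: (A *m x.2) - x.1 *: (A *m y.2)))) //.
by rewrite oppr0 opprB.
Qed.
Fact sd_lbr_linr x : linear (sd_lbr x).
Proof.
by move=> a u v; rewrite sd_lbrC sd_lbr_linl (sd_lbrC x u) (sd_lbrC x v) opprD scalerN.
Qed.
Fact sd_lbrxx x : sd_lbr x x = 0.
Proof. by rewrite /sd_lbr subrr. Qed.
Fact sd_lbr_jacobi x y z :
  sd_lbr x (sd_lbr y z) + sd_lbr y (sd_lbr z x) + sd_lbr z (sd_lbr x y) = 0.
Proof.
rewrite /sd_lbr /= !scale0r !subr0.
set a := x.1 *: _; set b := y.1 *: _; set c := z.1 *: _.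
rewrite [LHS](_ : _ = (0 + 0 + 0, a + b + c)) // !addr0 /a /b /c.
suff -> : (x.1 *: (A *m (y.1 *: (A *m z.2) - z.1 *: (A *m y.2))) +
   y.1 *: (A *m (z.1 *: (A *m x.2) - x.1 *: (A *m z.2))) +
   z.1 *: (A *m (x.1 *: (A *m y.2) - y.1 *: (A *m x.2)))) = 0 :> 'cV[K]_d by [].
rewrite !mulmxBr -!scalemxAr !scalerBr !scalerA.
rewrite (mulrC y.1 x.1) (mulrC z.1 x.1) (mulrC z.1 y.1).
set p := _ *: _; set q := _ *: _; set r := _ *: _.
by rewrite [p - q + _]addrC !subrKA subrr.
Qed.

Definition semidirect : lieAlgebra K :=
  LieAlgebra sd_lbr_linl sd_lbr_linr sd_lbrxx sd_lbr_jacobi.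
End SemidirectLie.

End LieTheory.

Arguments h3 K : clear implicits.

Section LieGroups.
Variable R : realType.

Definition mx_pseries (a : nat -> R) (d : nat) (A : 'M[R]_d) : 'M[R]_d :=
  limn (series (fun k => a k *: A ^+ k)).

Definition mx_exp (d : nat) (A : 'M[R]_d) : 'M[R]_d :=
  mx_pseries (fun k => k`!%:R^-1) A.

Definition mx_Phi (d : nat) (A : 'M[R]_d) : 'M[R]_d :=
  mx_pseries (fun k => (k.+1)`!%:R^-1) A.

Definition sd_mul (d : nat) (A : 'M[R]_d) (x y : R^o * 'cV[R]_d) :
    R^o * 'cV[R]_d :=
  (x.1 + y.1, x.2 + mx_exp ((x.1 : R) *: A) *m y.2).

(* Class C^n, via directional derivatives; on finite-dimensional spaces this is
   the usual notion. *)
Fixpoint Ck (n : nat) (V W : normedModType R) (F : V -> W) : Prop :=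
  if n is n'.+1 then
    (forall x, differentiable F x) /\ forall v, Ck n' (fun x => 'd F x v)
  else continuous F.

Definition smooth (V W : normedModType R) (F : V -> W) : Prop :=
  forall n, Ck n F.

(* Isomorphism of Lie groups whose underlying manifolds are V and W, with
   multiplications mV and mW. *)
Definition lie_group_iso (V W : normedModType R)
    (mV : V -> V -> V) (mW : W -> W -> W) (F : V -> W) : Prop :=
  [/\ smooth F,
      exists2 G : W -> V, smooth G & cancel F G /\ cancel G F
    & forall x y, F (mV x y) = mW (F x) (F y)].

End LieGroups.

(* Main.v *)
(* (i) If f does not map the ideal R^d into R^d, then f(R^d) is a second abelian
   ideal of codimension one; since f(R^d) /\ R^d is central, A2 has rank one, and
   since f(R^d) contains all brackets, A2^2 = 0.  Then g2 is h_3 x R^(d-2).  So f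
   has the announced form, with L A1 = mu A2 L; hence A1 is similar to (mu/c) A1.
   The coefficients p_k of its characteristic polynomial then satisfy
   (mu/c)^k p_k = (mu/c)^d p_k, so that they vanish for k < d unless |mu/c| = 1,
   and A1 is nilpotent by Cayley-Hamilton.

   (ii) As (t,v) = (0,v)(t,0), F is determined by the one-parameter subgroups
   t |-> F(t,0) and t |-> F(0,tv).  A one-parameter subgroup (a, b) of G_A with
   tangent vector (m,w) satisfies a(t) = mt and b(t+h) = b(t) + e^(mtA) b(h), so
   b' = e^(mtA) w, while the entries of t Phi(mtA) are real power series with
   derivative those of e^(mtA). *)
From HB Require Import structures.
Require Import Defs.
From mathcomp Require Import ring zify.
Set Implicit Arguments.
Unset Strict Implicit.
Unset Printing Implicit Defensive.
Import Order.TTheory GRing.Theory Num.Theory.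
Import numFieldNormedType.Exports.
Local Open Scope ring_scope.

(** * Matrices similar to a scalar multiple of themselves *)

Section MatrixNilpotent.
Variable K : fieldType.

Lemma scaled_conj_nilpotent n (A Q : 'M[K]_n) (a : K) :
  Q \in unitmx -> Q *m A = a *: (A *m Q) -> a != 0 ->
  (forall k, (0 < k)%N -> a ^+ k != 1) -> A ^+ n = 0.
Proof.
move=> uQ QA a0 aX.
pose p := char_poly A.
have p_scale : p \Po (a *: 'X) = a ^+ n *: p.
  have hE : map_mx (comp_poly (a *: 'X)) (char_poly_mx A) =
      (a *: 'X)%:M - map_mx polyC A.
    apply/matrixP => i j; rewrite !mxE raddfB raddfMn/= comp_polyX.
    by rewrite comp_polyC.
  (* Since QA = aAQ, one has Q(aX - A) = a(X - A)Q over the polynomial ring; determinants then give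
     p(aX) = a^n p(X), as det Q can be cancelled. *)
  have QhE : map_mx polyC Q *m map_mx (comp_poly (a *: 'X)) (char_poly_mx A) =
      a%:P *: (char_poly_mx A *m map_mx polyC Q).
    rewrite hE mulmxBr mulmxBl -map_mxM QA map_mxZ map_mxM scalerBr.
    by rewrite mul_mx_scalar mul_scalar_mx scalerA mul_polyC.
  have := congr1 determinant QhE.
  rewrite det_mulmx detZ det_mulmx !det_map_mx/= -[\det (char_poly_mx A)]/p.
  have detQ : (\det Q)%:P != 0 by rewrite polyC_eq0 -unitfE -unitmxE.
  by rewrite mulrA [RHS]mulrC => /(mulfI detQ) ->; rewrite -polyC_exp mul_polyC.
have p_low k : (k < n)%N -> p`_k = 0.
  move=> kn; have := congr1 (fun q : {poly K} => q`_k) p_scale.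
  have kp : (k < size p)%N by rewrite size_char_poly ltnS ltnW.
  rewrite coefZ coef_comp_poly (bigD1 (Ordinal kp))//= exprZn coefZ coefXn eqxx.
  rewrite mulr1 big1 ?addr0 => [|i]; last first.
    by rewrite -val_eqE/= exprZn coefZ coefXn eq_sym => /negPf ->; rewrite !mulr0.
  (* The equality a^k p_k = a^n p_k becomes (1 - a^(n-k)) a^k p_k = 0, whose first two factors are
     nonzero. *)
  move=> /eqP; rewrite -[n in a ^+ n](subnK (ltnW kn)) exprD -subr_eq0.
  rewrite (_ : _ - _ = (1 - a ^+ (n - k)) * (a ^+ k * p`_k)); last by ring.
  rewrite !mulf_eq0 subr_eq0 eq_sym expf_eq0 (negPf a0) andbF/=.
  by rewrite (negPf (aX _ _)) ?subn_gt0//= => /eqP.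
have pE : p = 'X^n.
  apply/polyP => k; rewrite coefXn; case: ltngtP => [/p_low//|nk|->].
    by rewrite nth_default// size_char_poly.
  have /monicP := char_poly_monic A.
  by rewrite lead_coefE size_char_poly.
case: n => [|n] in A Q uQ QA aX p p_scale p_low pE *; first exact: thinmx0.
by have := Cayley_Hamilton A; rewrite -/p pE rmorphXn/= horner_mx_X.
Qed.

End MatrixNilpotent.

(** * Bijectivity from a trivial kernel by rank-nullity *)

Section LinearBijection.
Variables (K : fieldType) (V W : vectType K).

Lemma linear_inj_bij (f : V -> W) : linear f -> (forall x, f x = 0 -> x = 0) ->
  dim V = dim W -> bijective f.
Proof.
move=> lf f0 dVW.
pose F : {linear V -> W} := HB.pack f (GRing.isLinear.Build _ _ _ _ f lf).
have kF : lker (linfun F) == 0%VS.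
  rewrite -subv0; apply/subvP => x; rewrite memv_ker lfunE memv0 => /eqP Fx.
  by apply/eqP/f0.
have iF : limg (linfun F) = fullv.
  apply/eqP; rewrite eqEdim subvf/= limg_dim_eq ?(eqP kF) ?capv0//.
  by rewrite !dimvf dVW.
exists (linfun F)^-1%VF => x.
  by rewrite -{2}(lker0_lfunK kF x) lfunE.
have := @limg_lfunVK _ _ _ (linfun F) x; rewrite iF memvf => /(_ isT).
by rewrite lfunE.
Qed.

End LinearBijection.

(** * Lower central series of a semidirect product *)

Section Semidirect.
Variables (K : fieldType) (d : nat).
Implicit Types A : 'M[K]_d.

(** Taken at a power A^k, its image is the subspace 0 x im(A^k) that bounds the lower central
    series. *)
Definition sd_incl A (w : 'cV[K]_d) : K^o * 'cV[K]_d := (0, A *m w).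

Fact sd_incl_linear A : linear (sd_incl A).
Proof.
move=> a u v; rewrite /sd_incl mulmxDr -scalemxAr.
by congr pair; rewrite /= scaler0 addr0.
Qed.
HB.instance Definition _ A :=
  GRing.isLinear.Build K 'cV[K]_d (K^o * 'cV[K]_d)%type _ (sd_incl A) (sd_incl_linear A).

(** Brackets have first component 0, and bracketing with an element of 0 x R^d applies A once more
    to it, up to a scalar. The index starts at 1 because the term of index 0 is the whole
    algebra. *)
Lemma lower_central_semidirect A n :
  (lower_central (semidirect A) n.+1 <= limg (linfun (sd_incl (A ^+ n.+1))))%VS.
Proof.
have imgE (k : nat) (w : 'cV_d) (s : K) :
    (0, s *: (A *m (A ^+ k *m w))) \in limg (linfun (sd_incl (A ^+ k.+1))).
  have -> : (0, s *: (A *m (A ^+ k *m w))) = linfun (sd_incl (A ^+ k.+1)) (s *: w).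
    by rewrite lfunE/= /sd_incl exprS -mulmxE -scalemxAr mulmxA.
  exact/memv_img/memvf.
elim: n => [|n IH]; apply/span_subvP => _ /allpairsP[[[t u] [s v]] /= [_ yU ->]].
  (* At the first level neither argument need lie in R^d, so both terms of the bracket survive;
     writing u and v with A^0 brings them to the form of [imgE]. *)
  have w0 (w : 'cV_d) : w = A ^+ 0 *m w by rewrite expr0 mul1mx.
  rewrite (w0 u) (w0 v).
  rewrite [X in X \in _](_ : _ =
      (0, t *: (A *m (A ^+ 0 *m v))) - (0, s *: (A *m (A ^+ 0 *m u)))).
    by rewrite rpredB.
  by congr pair; rewrite /= subr0.
have /memv_imgP[w _] := subvP IH _ (vbasis_mem yU).
rewrite lfunE/= /sd_incl => -[-> ->]; rewrite /sd_lbr/= scale0r subr0.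
exact: imgE.
Qed.

Lemma semidirect_nilpotent A n : A ^+ n = 0 -> lie_nilpotent (semidirect A).
Proof.
move=> An; exists n.+1; apply/eqP; rewrite -subv0.
apply: subv_trans (lower_central_semidirect A n) _.
apply/subvP => _ /memv_imgP[w _ ->].
by rewrite lfunE/= /sd_incl exprS An mulr0 mul0mx mem0v.
Qed.

End Semidirect.

(** * Rank-one matrices of square zero and the Heisenberg algebra *)

Section Heisenberg.
Variable K : fieldType.

Lemma mulmx_colP m n (A B : 'M[K]_(m, n)) :
  (forall x : 'cV_n, A *m x = B *m x) -> A = B.
Proof.
move=> AB; apply/matrixP => i j.
by have /colP/(_ i) := AB (delta_mx j 0); rewrite -!colE !mxE.
Qed.

Lemma outer_scale d (z : 'cV[K]_d) (phi : 'rV[K]_d) (x : 'cV[K]_d) :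
  z *m phi *m x = (phi *m x) 0 0 *: z.
Proof. by rewrite -mulmxA {1}[phi *m x]mx11_scalar mul_mx_scalar. Qed.

(** Square zero forces phi z = 0, so z is central. If phi e = 1, then [(1,0),(0,e)] = (0,z), so
    (1,0), e and z span a copy of h_3; a complement of the line of z in the kernel of phi is the
    abelian factor. *)
Lemma semidirect_rank1_nilpotent d (z : 'cV[K]_d) (phi : 'rV[K]_d) :
  z *m phi != 0 -> (z *m phi) *m (z *m phi) = 0 ->
  lie_isomorphic (semidirect (z *m phi))
    (prod_lie (h3 K) (abelian_lie 'cV[K]_(d - 2))).
Proof.
move=> zphi0 zphi2.
have z0 : z != 0 by apply: contraNneq zphi0 => ->; rewrite mul0mx.
have [j phij] : exists j, phi 0 j != 0.
  apply/existsP; apply: contraNT zphi0; rewrite negb_exists => /forallP phi0.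
  suff -> : phi = 0 by rewrite mulmx0.
  by apply/rowP => j; rewrite mxE; apply/eqP; rewrite -[_ == _]negbK.
have [e phie] : exists e : 'cV_d, (phi *m e) 0 0 = 1.
  by exists ((phi 0 j)^-1 *: delta_mx j 0); rewrite -scalemxAr -colE !mxE mulVf.
have phiz : (phi *m z) 0 0 = 0.
  have : (phi *m z) 0 0 *: z = 0.
    have ze : z *m phi *m e = z by rewrite outer_scale phie scale1r.
    by rewrite -outer_scale -{2}ze mulmxA zphi2 mul0mx.
  by move=> /eqP; rewrite scaler_eq0 (negPf z0) orbF => /eqP.
pose M := row_mx z e.
have Mc (c : 'cV_(1 + 1)) : M *m c = c (lshift 1 0) 0 *: z + c (rshift 1 0) 0 *: e.
  rewrite -[c in LHS]vsubmxK mul_row_col.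
  by rewrite [usubmx c]mx11_scalar [dsubmx c]mx11_scalar !mul_mx_scalar !mxE.
have phiM (c : 'cV_(1 + 1)) : (phi *m (M *m c)) 0 0 = c (rshift 1 0) 0.
  rewrite Mc mulmxDr -!scalemxAr mxE [X in X + _]mxE [X in _ + X]mxE.
  by rewrite phiz phie mulr0 mulr1 add0r.
have rM : \rank M = 2.
  rewrite -mxrank_tr; apply/eqP; apply: inj_row_free => v.
  move=> /(congr1 trmx); rewrite trmx_mul trmxK trmx0 => Mv0.
  have c1 : v^T (rshift 1 0) 0 = 0 by rewrite -phiM Mv0 mulmx0 mxE.
  have c0 : v^T (lshift 1 0) 0 = 0.
    have /esym/eqP := Mc v^T.
    by rewrite Mv0 c1 scale0r addr0 scaler_eq0 (negPf z0) orbF => /eqP.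
  apply: trmx_inj; rewrite trmx0; apply/colP => i.
  by case: (split_ordP i) => k ->; rewrite ord1 ?c0 ?c1 mxE.
have d2 : (2 <= d)%N by have := rank_leq_row M; rewrite rM.
have [d' dE] : exists d', d = (1 + 1 + d')%N by exists (d - 2)%N; rewrite subnKC.
subst d; rewrite addKn.
(* Completes z, e to a basis: in the rank factorization of M, the right factor is enlarged to an
   invertible square block, and M becomes the first two columns of [col_ebase M *m B]. *)
pose B : 'M[K]_(1 + 1 + d') := block_mx (row_ebase M) 0 0 1%:M.
have uCB : col_ebase M *m B \in unitmx.
  rewrite unitmx_mul col_ebase_unit unitmxE det_ublock det1 mulr1 -unitmxE.
  exact: row_ebase_unit.
have ME : M = col_ebase M *m B *m col_mx 1%:M 0.
  rewrite -{1}(mulmx_ebase M) rM pid_mx_col -!mulmxA; congr (_ *m _).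
  by rewrite mul_col_mx mul_block_col !mulmx1 !mul1mx !mul0mx !addr0.
pose Q := invmx (col_ebase M *m B).
have uQ : Q \in unitmx by rewrite unitmx_inv.
have QM : Q *m M = col_mx 1%:M 0 by rewrite [in LHS]ME mulKmx.
have [p pE] : exists p : 'cV[K]_(1 + 1 + d') -> K, forall x, p x = (phi *m x) 0 0.
  by eexists.
have [q qE] : exists q : 'cV[K]_(1 + 1 + d') -> K, forall x,
    q x = (usubmx (Q *m x)) (lshift 1 0) 0 by eexists.
have plin a u v : p (a *: u + v) = a * p u + p v.
  by rewrite !pE mulmxDr -scalemxAr mxE [X in X + _]mxE.
have qlin a u v : q (a *: u + v) = a * q u + q v.
  rewrite !qE mulmxDr -scalemxAr linearD linearZ.
  by rewrite [LHS]mxE [X in X + _]mxE.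
(* Q z and Q e are the first two vectors of the standard basis, so that q x is
   the coordinate of x along z; phi plays the role of the second coordinate of
   h_3, in which z becomes e_2. *)
pose T (x : K^o * 'cV[K]_(1 + 1 + d')) : 'cV[K]_3 * 'cV[K]_d' :=
  (\col_i nth 0 [:: x.1; p x.2; q x.2] i, dsubmx (Q *m x.2)).
have Tlin : linear T.
  move=> a u v; congr pair.
    by apply/colP => -[[|[|[|//]]] ?]; rewrite !mxE/= ?plin ?qlin.
  by rewrite /= mulmxDr -scalemxAr linearD linearZ.
have zM : z = M *m delta_mx (lshift 1 0) 0.
  by rewrite Mc !mxE !eqxx/= scale1r scale0r addr0.
have pz : p z = 0 by rewrite pE.
have qz : q z = 1.
  by rewrite qE [in X in Q *m X]zM mulmxA QM mul_col_mx col_mxKu mul1mx mxE !eqxx.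
have Nz : dsubmx (Q *m z) = 0.
  by rewrite [in X in Q *m X]zM mulmxA QM mul_col_mx col_mxKd mul0mx.
exists T; split=> //.
- apply: (linear_inj_bij Tlin); last first.
    have dK : dim (K^o : vectType K) = 1 by [].
    by rewrite [LHS]/(dim _ + dim _)%N [RHS]/(dim _ + dim _)%N dK !dim_matrix; lia.
  move=> [t x] /= E.
  have /colP Eu := congr1 fst E; have /= Ed := congr1 snd E.
  have := Eu 0; have := Eu 1; have := Eu (inord 2).
  rewrite !mxE/= inordK//= => qx px ->; congr pair.
  (* As the last d' coordinates of Q x vanish, x lies in the span of z and e, and its two
     coefficients are q x and p x. *)
  have xM : x = M *m usubmx (Q *m x).
    apply: (can_inj (mulKmx uQ)); rewrite mulmxA QM mul_col_mx mul1mx mul0mx.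
    by rewrite -{1}[Q *m x]vsubmxK Ed.
  have r0 : usubmx (Q *m x) (rshift 1 0) 0 = 0 by rewrite -phiM -xM -pE.
  have l0 : usubmx (Q *m x) (lshift 1 0) 0 = 0 by rewrite -qE.
  by rewrite xM Mc l0 r0 !scale0r addr0.
- move=> [t x] [s y].
  (* All brackets of the source are multiples of (0,z), so only the values of T on this line
     matter. *)
  have Tz c : T (0, c *: z) = (c *: delta_mx ord_max 0, 0).
    rewrite -[c *: z]addr0; congr pair; last first.
      by rewrite /= addr0 -scalemxAr linearZ/= Nz scaler0.
    have p0 : p 0 = 0 by rewrite pE mulmx0 mxE.
    have q0 : q 0 = 0 by rewrite qE mulmx0 linear0 mxE.
    apply/colP => -[[|[|[|//]]] ?]; rewrite !mxE/= ?plin ?qlin ?pz ?qz ?p0 ?q0.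
    + by rewrite mulr0.
    + by rewrite addr0 !mulr0.
    + by rewrite addr0.
  have -> : lbr ((t, x) : semidirect (z *m phi)) (s, y) = (0, (t * p y - p x * s) *: z).
    by rewrite /= /sd_lbr/= !outer_scale -!pE !scalerA -scalerBl [p x * s]mulrC.
  rewrite Tz -[RHS]/(prod_lbr _ _) /prod_lbr/= /h3_lbr /ab_lbr/=.
  by rewrite !mxE.
Qed.

End Heisenberg.

(** * Isomorphisms between semidirect products *)

Section Iso.
Variables (K : fieldType) (d : nat) (A1 A2 : 'M[K]_d).
Variable f : semidirect A1 -> semidirect A2.
Hypothesis isof : lie_iso f.

Let flin : linear f. Proof. by case: isof. Qed.
Let fB x y : f (lbr x y) = lbr (f x) (f y). Proof. by case: isof. Qed.

Lemma sd_iso_surj x : exists t u, f (t, u) = x.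
Proof.
by case: isof => _ [g _ gK] _; exists (g x).1, (g x).2; rewrite -surjective_pairing.
Qed.

Lemma sd_iso_decomp t u : f (t, u) = t *: f (1, 0) + f (0, u).
Proof.
rewrite -flin; congr f; congr pair; rewrite /= ?scaler0 ?add0r//.
by rewrite addr0 [_ *: _]mulr1.
Qed.

Lemma sd_iso0 : f 0 = 0.
Proof. by have := flin (-1) 0 0; rewrite scaleN1r oppr0 addr0 scaleN1r addNr. Qed.

Lemma sd_iso_not_ideal v : (f (0, v)).1 != 0 ->
  exists (z : 'cV[K]_d) (phi : 'rV[K]_d), A2 = z *m phi /\ A2 *m A2 = 0.
Proof.
set s := (f (0, v)).1; set w := (f (0, v)).2 => s0.
(* This is [f(0,v), f(0,u)] = 0 written out and divided by s. *)
have ab u : A2 *m (f (0, u)).2 = ((f (0, u)).1 / s) *: (A2 *m w).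
  have : lbr (f (0, v)) (f (0, u)) = 0.
    rewrite -fB -[RHS]sd_iso0; congr f; rewrite /= /sd_lbr/=.
    by rewrite !scale0r subrr.
  move=> /(congr1 snd) /= /eqP; rewrite subr_eq0 -/s -/w => /eqP E.
  by rewrite mulrC -scalerA -E scalerA mulVf// scale1r.
have rk1 : exists z : 'cV_d, forall x, exists t, A2 *m x = t *: z.
  (* Write (0,x) = t f(1,0) + f(0,u). The first components give f(0,u).1 = - t f(1,0).1, and [ab]
     then turns A2 x into t times this vector. *)
  exists (A2 *m (f (1, 0)).2 - ((f (1, 0)).1 / s) *: (A2 *m w)) => x.
  have [t [u ftu]] := sd_iso_surj (0, x); exists t.
  have := ftu; rewrite sd_iso_decomp => E.
  have /= E1 := congr1 fst E; have /= E2 := congr1 snd E.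
  rewrite -E2 mulmxDr ab -scalemxAr.
  rewrite (_ : (f (0, u)).1 = - (t * (f (1, 0)).1)); last first.
    by apply/eqP; rewrite -addr_eq0 addrC; apply/eqP.
  by rewrite scalerBr scalerA mulNr scaleNr mulrA.
(* The vector (0, A2 x) = [(1,0),(0,x)] is the image of a bracket, hence of some (0,u); [ab] applies
   with first component 0. *)
have sq0 (x : 'cV_d) : A2 *m (A2 *m x) = 0.
  have [t1 [u1 f1]] := sd_iso_surj (1, 0); have [t2 [u2 f2]] := sd_iso_surj (0, x).
  have E : f (lbr ((t1, u1) : semidirect A1) (t2, u2)) = (0, A2 *m x).
    by rewrite fB f1 f2 /= /sd_lbr/= scale1r scale0r subr0.
  move: E; rewrite /= /sd_lbr/=; set u := _ - _ => E.
  by have := ab u; rewrite E/= mul0r scale0r.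
have [z zP] := rk1.
have [phi phiP] := fin_all_exists (fun j => zP (delta_mx j 0)).
exists z, (\row_j phi j); split.
  apply/matrixP => i j; have /colP/(_ i) := phiP j.
  by rewrite -colE !mxE big_ord1 mxE mulrC.
by apply: mulmx_colP => x; rewrite mul0mx -mulmxA.
Qed.

(** Here (mu, v0) is f(1,0) and L is the matrix of f on R^d. Surjectivity gives mu != 0, injectivity
    makes L invertible, and the last relation is f applied to [(1,0),(0,v)]. *)
Lemma sd_iso_form : (forall v, (f (0, v)).1 = 0) ->
  exists (mu : K) (v0 : 'cV[K]_d) (L : 'M[K]_d),
    [/\ mu != 0, L \in unitmx,
      forall (t : K) (v : 'cV[K]_d), f (t, v) = (mu * t, L *m v + t *: v0)
    & L *m A1 = mu *: (A2 *m L)].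
Proof.
move=> f1.
pose L := \matrix_(i, j) (f (0, delta_mx j 0)).2 i 0.
have f2lin : linear (fun v => (f (0, v)).2).
  move=> a u v; rewrite -[RHS]/((a *: f (0, u) + f (0, v)).2) -flin.
  by congr (f _).2; congr pair; rewrite /= scaler0 addr0.
have LE v : f (0, v) = (0, L *m v).
  rewrite [LHS]surjective_pairing f1; congr pair.
  pose F : {linear 'cV[K]_d -> 'cV[K]_d} := HB.pack (fun v => (f (0, v)).2)
    (GRing.isLinear.Build _ _ _ _ (fun v => (f (0, v)).2) f2lin).
  rewrite -[LHS]/(F v) {1}(matrix_sum_delta v) linear_sum/=.
  apply/colP => i; rewrite summxE mxE; apply: eq_bigr => j _.
  rewrite big_ord1 -[(f (0, _)).2]/(F (v j 0 *: delta_mx j 0)) linearZ/=.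
  by rewrite !mxE mulrC.
set mu := (f (1, 0)).1; set v0 := (f (1, 0)).2.
have fE (t : K) (v : 'cV[K]_d) : f (t, v) = (mu * t, L *m v + t *: v0).
  rewrite sd_iso_decomp LE; congr pair; first by rewrite /= addr0 [_ *: _]mulrC.
  by rewrite /= addrC.
have mu0 : mu != 0.
  have [t [u]] := sd_iso_surj (1, 0); rewrite fE => -[E _].
  by apply: contra_eq_neq E => ->; rewrite mul0r eq_sym oner_neq0.
exists mu, v0, L; split=> //.
- rewrite -unitmx_tr -row_free_unit; apply: inj_row_free => v.
  move=> /(congr1 trmx); rewrite trmx_mul trmxK trmx0 => Lv.
  have : f (0, v^T) = f 0 by rewrite LE Lv sd_iso0.
  have [_ /bij_inj fI _] := isof => /fI [] /(congr1 trmx).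
  by rewrite trmxK trmx0.
- apply: mulmx_colP => v.
  have := fB (1, 0) (0, v).
  rewrite /= /sd_lbr/= !scale0r scale1r !subr0 LE fE LE /= mulr1 scale0r subr0.
  by move=> [E]; rewrite -mulmxA E -scalemxAl mulmxA.
Qed.

End Iso.

(** * Matrix power series and one-parameter subgroups *)

Section OneParameterSubgroups.
Local Open Scope classical_set_scope.
Variable R : realType.

Lemma expmxZ d (t : R) (A : 'M[R]_d) k : (t *: A) ^+ k = t ^+ k *: A ^+ k.
Proof.
elim: k => [|k IH]; first by rewrite !expr0 scale1r.
by rewrite !exprS IH -!mulmxE -scalemxAl -scalemxAr scalerA.
Qed.

Lemma cvg_mx (T : Type) (F : set_system T) (FF : Filter F) m n
    (u : T -> 'M[R]_(m, n)) (M : 'M[R]_(m, n)) :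
  (forall i j, u x i j @[x --> F] --> M i j) -> u x @[x --> F] --> M.
Proof.
move=> uM A [P MP PA]; apply: (@filterS _ F _ _ _ (fun x => PA (u x))).
by apply: filter_forall => i; apply: filter_forall => j; exact: (uM i j _ (MP i j)).
Qed.

(** The base dominates every row sum of absolute values, which drives the induction; its summand 1
    keeps it at least 1, so that its powers do not decrease. *)
Lemma mx_pow_entry_bound d (A : 'M[R]_d) k i j :
  `|(A ^+ k) i j| <= (1 + \sum_p \sum_q `|A p q|) ^+ k.
Proof.
set M := _ + _.
have M1 : 1 <= M by rewrite lerDl; apply: sumr_ge0 => p _; exact: sumr_ge0.
elim: k i j => [|k IH] i j.
  by rewrite !expr0 mxE; case: (i == j); rewrite ?normr1 ?normr0.
rewrite !exprS -mulmxE mxE (le_trans (ler_norm_sum _ _ _))//.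
apply: (@le_trans _ _ (\sum_l `|A i l| * M ^+ k)).
  by apply: ler_sum => l _; rewrite normrM ler_wpM2l.
rewrite -mulr_suml ler_wpM2r ?exprn_ge0 ?(le_trans ler01)//.
rewrite /M [X in 1 + X](bigD1 i)//= addrCA lerDl addr_ge0//.
by apply: sumr_ge0 => p _; exact: sumr_ge0.
Qed.

(** Comparison with C times the exponential series at M|x|. It covers the entries of exp and Phi as
    well as their derived series. *)
Lemma is_cvg_pseries_exp_type (c : nat -> R) (C M x : R) :
  (forall k, `|c k| <= C * M ^+ k / k`!%:R) -> cvgn (pseries c x).
Proof.
move=> cM; apply: normed_cvg.
have cMx k : `|c k * x ^+ k| <= C * M ^+ k / k`!%:R * `|x| ^+ k.
  by rewrite normrM normrX ler_wpM2r// exprn_ge0.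
apply: (series_le_cvg _ _ cMx) => [k|k|] /=; first exact: normr_ge0.
  exact: le_trans (normr_ge0 _) (cMx k).
rewrite (_ : (fun _ => _) = C *: exp_coeff (M * `|x|)).
  exact/is_cvg_seriesZ/is_cvg_series_exp_coeff.
apply/funext => k; rewrite /exp_coeff fctE/= exprMn.
by rewrite [_ *: _]/GRing.scale/= !mulrA [RHS]mulrAC.
Qed.

(** Limits of matrices are taken entrywise; along the line tA each entry is a real power series in
    t, which can be differentiated termwise. *)
Lemma mx_pseriesE (a : nat -> R) d (A : 'M[R]_d) (t : R) i j :
  (forall i j, cvgn (pseries (fun k => a k * (A ^+ k) i j) t)) ->
  mx_pseries a (t *: A) i j = limn (pseries (fun k => a k * (A ^+ k) i j) t).
Proof.
move=> cA; rewrite /mx_pseries.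
have E p q n : series (fun k => a k *: (t *: A) ^+ k) n p q =
    pseries (fun k => a k * (A ^+ k) p q) t n.
  rewrite /pseries /series/= summxE; apply: eq_bigr => k _.
  by rewrite expmxZ !mxE mulrA mulrAC.
have lim_entries : series (fun k => a k *: (t *: A) ^+ k) @ \oo -->
    (\matrix_(p, q) limn (pseries (fun k => a k * (A ^+ k) p q) t) : 'M[R]_d).
  apply: cvg_mx => p q; rewrite mxE.
  by under eq_fun do rewrite E; exact: cA.
by rewrite (cvg_lim _ lim_entries) ?mxE//; exact: norm_hausdorff.
Qed.

Lemma is_cvg_mx_exp_entry d (A : 'M[R]_d) (t : R) i j :
  cvgn (pseries (fun k => k`!%:R^-1 * (A ^+ k) i j) t).
Proof.
apply: (is_cvg_pseries_exp_type (C := 1) (M := 1 + \sum_p \sum_q `|A p q|)) => k.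
rewrite mul1r normrM normfV normr_nat mulrC ler_wpM2r ?invr_ge0//.
exact: mx_pow_entry_bound.
Qed.

Lemma is_cvg_mx_Phi_entry d (A : 'M[R]_d) (t : R) i j :
  cvgn (pseries (fun k => k.+1`!%:R^-1 * (A ^+ k) i j) t).
Proof.
apply: (is_cvg_pseries_exp_type (C := 1) (M := 1 + \sum_p \sum_q `|A p q|)) => k.
rewrite mul1r normrM normfV normr_nat mulrC ler_pM ?invr_ge0 ?mx_pow_entry_bound//.
by rewrite lef_pV2 ?posrE ?ltr0n ?fact_gt0// ler_nat factS leq_pmull.
Qed.

Lemma mx_exp0 d (A : 'M[R]_d) : mx_exp (0 *: A) = 1%:M.
Proof.
apply/matrixP => i j; rewrite [LHS]mx_pseriesE; last first.
  by move=> *; exact: is_cvg_mx_exp_entry.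
apply/cvg_lim; first exact: Rhausdorff.
(* The partial sum of index 0 is empty; from index 1 on the partial sums at 0 equal the constant
   term. *)
apply: cvg_near_cst; exists 1%N => // -[|n]//= _.
rewrite /pseries /series/= big_nat_recl// big1 ?addr0 => [|k _].
  by rewrite fact0 invr1 mul1r !expr0 mulr1.
by rewrite expr0n mulr0.
Qed.

Lemma mx_Phi0 d (A : 'M[R]_d) : mx_Phi (0 *: A) = 1%:M.
Proof.
apply/matrixP => i j; rewrite [LHS]mx_pseriesE; last first.
  by move=> *; exact: is_cvg_mx_Phi_entry.
apply/cvg_lim; first exact: Rhausdorff.
apply: cvg_near_cst; exists 1%N => // -[|n]//= _.
rewrite /pseries /series/= big_nat_recl// big1 ?addr0 => [|k _].
  by rewrite invr1 mul1r !expr0 mulr1.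
by rewrite expr0n mulr0.
Qed.

Lemma is_derive_mx_Phi d (A : 'M[R]_d) (t : R) i j :
  is_derive t (1 : R) (fun s : R => s * mx_Phi (s *: A) i j)
    (mx_exp (t *: A) i j).
Proof.
pose M := 1 + \sum_p \sum_q `|A p q|.
have M1 : 1 <= M by rewrite lerDl; apply: sumr_ge0 => p _; exact: sumr_ge0.
(* Coefficients of the entry of s Phi(sA): those of Phi shifted by one place. Termwise
   differentiation turns them into those of the exponential. *)
pose c k := if k is k'.+1 then k`!%:R^-1 * (A ^+ k') i j else 0.
have diffs_c : pseries_diffs c = fun k => k`!%:R^-1 * (A ^+ k) i j.
  apply/funext => k; rewrite /pseries_diffs/= factS natrM invfM !mulrA.
  by rewrite mulfV ?pnatr_eq0// mul1r.
have -> : (fun s : R => s * mx_Phi (s *: A) i j) = fun s => limn (pseries c s).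
  apply/funext => s; rewrite [mx_Phi _ i j]mx_pseriesE; last first.
    by move=> *; exact: is_cvg_mx_Phi_entry.
  apply/esym/cvg_lim; first exact: Rhausdorff.
  rewrite -cvg_shiftS/=.
  have -> : (fun n => pseries c s n.+1) =
      fun n => s * pseries (fun k => k.+1`!%:R^-1 * (A ^+ k) i j) s n.
    apply/funext => n; rewrite /pseries /series/= big_nat_recl//= mul0r add0r.
    by rewrite mulr_sumr; apply: eq_bigr => k _; rewrite exprS mulrCA.
  by apply: cvgMr; exact: is_cvg_mx_Phi_entry.
have -> : mx_exp (t *: A) i j = limn (pseries (pseries_diffs c) t).
  by rewrite [LHS]mx_pseriesE ?diffs_c// => *; exact: is_cvg_mx_exp_entry.
(* Termwise differentiation at t asks for convergence of the series and of its first two derived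
   series at a point of larger modulus. The second has coefficients A^(k+1)/k!, whence the constant
   C = M there. *)
apply: (@pseries_snd_diffs _ _ (`|t| + 1)).
- apply: (is_cvg_pseries_exp_type (C := 1) (M := M)) => -[|k] /=.
    by rewrite normr0 expr0 fact0 divr1 mulr1.
  rewrite mul1r normrM normfV normr_nat mulrC ler_wpM2r ?invr_ge0//.
  rewrite (le_trans (mx_pow_entry_bound _ _ _ _))// -/M exprS ler_peMl//.
  by rewrite exprn_ge0// (le_trans ler01).
- by rewrite diffs_c; exact: is_cvg_mx_exp_entry.
- apply: (is_cvg_pseries_exp_type (C := M) (M := M)) => k.
  rewrite diffs_c /pseries_diffs factS natrM invfM !mulrA.
  rewrite mulfV ?pnatr_eq0// mul1r normrM normfV normr_nat mulrC.
  by rewrite ler_wpM2r ?invr_ge0// -exprS; exact: mx_pow_entry_bound.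
- by rewrite [ltRHS]ger0_norm ?addr_ge0// ltrDl.
Qed.

(** Moves differentiation to 0, where the functional equation of a one-parameter subgroup yields the
    derivative at every t. *)
Lemma is_derive1_shift (f : R -> R) (t l : R) :
  is_derive (0 : R) (1 : R) (fun h => f (h + t)) l -> is_derive t (1 : R) f l.
Proof.
move=> [df <-]; split.
  by move: df; rewrite /derivable/=; under eq_fun do rewrite addr0 add0r.
by rewrite /derive/=; congr lim; under [in RHS]eq_fun do rewrite addr0 add0r.
Qed.

Lemma one_parameter_subgroupE d (A : 'M[R]_d) (a : R -> R) (b : R -> 'cV[R]_d)
    (m : R) (w : 'cV[R]_d) :
  (forall s t, a (s + t) = a s + a t) ->
  (forall s t, b (s + t) = b s + mx_exp (a s *: A) *m b t) ->
  is_derive (0 : R) (1 : R) a m ->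
  (forall i, is_derive (0 : R) (1 : R) (fun t => b t i 0) (w i 0)) ->
  forall t, a t = m * t /\ b t = t *: (mx_Phi ((m * t) *: A) *m w).
Proof.
move=> aD bD da db.
have a0 : a 0 = 0 by apply: (addrI (a 0)); rewrite -aD !addr0.
have b0 : b 0 = 0.
  have := bD 0 0; rewrite addr0 a0 mx_exp0 mul1mx -{1}[b 0]addr0.
  by move=> /addrI.
have aE t : a t = m * t.
  apply/eqP; rewrite -subr_eq0; apply/eqP.
  transitivity (a 0 - m * 0); last by rewrite a0 mulr0 subrr.
  apply: (is_derive_0_is_cst (f := fun t => a t - m * t)) => s.
  have da_s : is_derive s (1 : R) a m.
    apply: is_derive1_shift; under eq_fun do rewrite aD.
    by apply: is_derive_eq; rewrite addr0.
  by apply: is_derive_eq; rewrite [m%:A]mulr1 subrr.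
move=> t; split=> //; apply/colP => i.
(* The i-th coordinate of the expected solution; b_i and y agree at 0 and have the same derivative,
   so their difference is constantly 0. *)
pose y s := \sum_j (s * mx_Phi (s *: (m *: A)) i j) * w j 0.
have -> : (t *: (mx_Phi ((m * t) *: A) *m w)) i 0 = y t.
  rewrite !mxE mulr_sumr; apply: eq_bigr => j _.
  by rewrite scalerA mulrA [m * t]mulrC.
apply/eqP; rewrite -subr_eq0; apply/eqP.
transitivity (b 0 i 0 - y 0); last first.
  by rewrite b0 mxE /y big1 ?subrr// => j _; rewrite !mul0r.
apply: (is_derive_0_is_cst (f := fun t => b t i 0 - y t)) => s.
have db_s : is_derive s (1 : R) (fun t => b t i 0)
    (\sum_j mx_exp (s *: (m *: A)) i j * w j 0).
  apply: is_derive1_shift.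
  (* By the functional equation at s + h, b(h + s) depends on h only through b(h), whose derivative
     at 0 is w. *)
  have -> : (fun h => b (h + s) i 0) = cst (b s i 0) +
      \sum_(j < d) (fun h => mx_exp (s *: (m *: A)) i j * b h j 0).
    apply/funext => h; rewrite addrC bD aE !mxE fctE fct_sumE/=.
    by congr (_ + _); apply: eq_bigr => j _; rewrite scalerA [m * s]mulrC.
  by apply: is_derive_eq; rewrite add0r.
have dy_s : is_derive s (1 : R) y
    (\sum_j mx_exp (s *: (m *: A)) i j * w j 0).
  have -> : y = \sum_(j < d) (fun s => (s * mx_Phi (s *: (m *: A)) i j) * w j 0).
    by apply/funext => h; rewrite fct_sumE.
  have dPhi j := is_derive_mx_Phi (m *: A) s i j.
  apply: is_derive_eq; apply: eq_bigr => j _.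
  by rewrite scaler0 add0r mulrC.
by apply: is_derive_eq; rewrite subrr.
Qed.

(** A continuous linear functional p commutes with difference quotients and their limits; it will be
    a coordinate of the target group. *)
Lemma is_derive_line (V W : normedModType R) (F : V -> W) (p : W -> R) (x : V) :
  differentiable F 0 -> linear p -> continuous p ->
  is_derive (0 : R) (1 : R) (fun t : R => p (F (t *: x))) (p ('d F 0 x)).
Proof.
move=> dF lp cp.
have pE (h : R) : h^-1 *: (p (F ((h *: (1 : R)) *: x)) - p (F (0 *: x))) =
    p (h^-1 *: (F (h *: x + 0) - F 0)).
  have pB := GRing.zmod_morphism_linear lp; have pZ := GRing.scalable_linear lp.
  by rewrite pZ pB addr0 scale0r [h *: (1 : R)]mulr1.
have cvF : p (h^-1 *: (F (h *: x + 0) - F 0)) @[h --> 0^'] --> p ('d F 0 x).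
  apply: continuous_cvg; first exact: cp.
  by rewrite -deriveE//; exact: diff_derivable.
split.
  by apply/cvg_ex; exists (p ('d F 0 x)); under eq_fun do rewrite /= addr0 pE.
by apply/cvg_lim => //; under eq_fun do rewrite /= addr0 pE; exact: cvF.
Qed.

Lemma sd_hom_one_parameter d (A : 'M[R]_d) (F : R^o * 'cV[R]_d -> R^o * 'cV[R]_d)
    (x y : R^o * 'cV[R]_d) :
  differentiable F (0, 0) ->
  (forall s t : R, F ((s + t) *: x) = sd_mul A (F (s *: x)) (F (t *: x))) ->
  'd F (0, 0) x = y ->
  forall t : R, F (t *: x) =
    (y.1 * t, t *: (mx_Phi (((y.1 : R) * t) *: A) *m y.2)).
Proof.
move=> dF FD <- t.
have [] := @one_parameter_subgroupE d A (fun t => (F (t *: x)).1)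
  (fun t => (F (t *: x)).2) ('d F (0, 0) x).1 ('d F (0, 0) x).2 _ _ _ _ t.
- by move=> s u; rewrite FD.
- by move=> s u; rewrite FD.
- apply: (is_derive_line (F := F) (p := fun z => z.1)) => //.
  by move=> z; exact: cvg_fst.
- move=> i; apply: (is_derive_line (F := F) (p := fun z => z.2 i 0)) => //.
    by move=> k u v; rewrite !mxE.
  move=> z; apply: (@continuous_comp _ _ _ snd (fun M : 'cV[R]_d => M i 0)).
    exact: cvg_snd.
  exact: coord_continuous.
- by case: (F _) => a b /= -> ->.
Qed.

Lemma sd_homE d (A1 A2 L : 'M[R]_d) (mu : R) (v0 : 'cV[R]_d)
    (F : R^o * 'cV[R]_d -> R^o * 'cV[R]_d) :
  differentiable F (0, 0) ->
  (forall x y, F (sd_mul A1 x y) = sd_mul A2 (F x) (F y)) ->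
  (forall (t : R) (v : 'cV[R]_d), 'd F (0, 0) (t, v) = (mu * t, L *m v + t *: v0)) ->
  forall (t : R) (v : 'cV[R]_d),
    F (t, v) = (mu * t, L *m v + t *: (mx_Phi ((mu * t) *: A2) *m v0)).
Proof.
move=> dF FM dFE t v.
have Ft : F (t, 0) = (mu * t, t *: (mx_Phi ((mu * t) *: A2) *m v0)).
  have := sd_hom_one_parameter (A := A2) (x := (1, 0)) dF _ (dFE 1 0) t.
  rewrite /= mulr1 mulmx0 add0r scale1r => <-.
    by congr F; congr pair; rewrite ?scaler0// [_ *: _]mulr1.
  move=> r s; rewrite -FM /sd_mul/= !scaler0 mulmx0 addr0; congr F.
  by congr pair; rewrite /= ?scaler0// scalerDl.
(* The tangent vector (0, Lv) has first component 0, so Phi is evaluated at 0, where it is the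
   identity. *)
have Fv : F (0, v) = (0, L *m v).
  have := sd_hom_one_parameter (A := A2) (x := (0, v)) dF _ (dFE 0 v) 1.
  rewrite /= mulr0 mul0r mx_Phi0 mul1mx !scale1r scale0r addr0.
  apply=> r s; rewrite -FM /sd_mul/=.
  have -> : r *: (0 : R^o) = 0 by rewrite scaler0.
  rewrite mx_exp0 mul1mx scalerDl; congr F.
  by congr pair; rewrite /= scaler0 add0r.
(* The order matters: the product (t,0)(0,v) would be (t, e^(tA1) v). *)
have -> : (t, v) = sd_mul A1 (0, v) (t, 0) by rewrite /sd_mul/= add0r mulmx0 addr0.
by rewrite FM Ft Fv /sd_mul/= mx_exp0 mul1mx add0r.
Qed.

End OneParameterSubgroups.

(** * Lie algebra and Lie group isomorphisms of almost abelian type *)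

Theorem theorem9p8 (R : realType) (d : nat) (A1 A2 P : 'M[R]_d) (c : R)
  (aab1 : almost_abelian (semidirect A1))
  (aab2 : almost_abelian (semidirect A2))
  (* almost abelian Lie algebras are understood to be non-abelian *)
  (nab : ~ lie_abelian (semidirect A1))
  (iso12 : lie_isomorphic (semidirect A1) (semidirect A2))
  (nh1 : ~ lie_isomorphic (semidirect A1)
             (prod_lie (h3 R) (abelian_lie 'cV[R]_(d - 2))))
  (nh2 : ~ lie_isomorphic (semidirect A2)
             (prod_lie (h3 R) (abelian_lie 'cV[R]_(d - 2))))
  (c0 : c != 0) (uP : P \in unitmx)
  (A1E : A1 = c *: (P *m A2 *m invmx P))
  (cnil : lie_nilpotent (semidirect A1) -> c = 1) :
  (forall f : semidirect A1 -> semidirect A2, lie_iso f ->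
     exists (mu : R) (v0 : 'cV[R]_d) (L : 'M[R]_d),
       [/\ mu != 0, L \in unitmx,
           forall (t : R) (v : 'cV[R]_d), f (t, v) = (mu * t, L *m v + t *: v0),
           L *m P *m A2 = (mu / c) *: (A2 *m L *m P)
         & ~ lie_nilpotent (semidirect A1) -> mu = c \/ mu = - c]) /\
  (forall (f : semidirect A1 -> semidirect A2)
          (mu : R) (v0 : 'cV[R]_d) (L : 'M[R]_d),
     lie_iso f -> mu != 0 -> L \in unitmx ->
     (forall (t : R) (v : 'cV[R]_d), f (t, v) = (mu * t, L *m v + t *: v0)) ->
     L *m P *m A2 = (mu / c) *: (A2 *m L *m P) ->
     forall F : R^o * 'cV[R]_d -> R^o * 'cV[R]_d,
       lie_group_iso (sd_mul A1) (sd_mul A2) F ->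
       (forall x, 'd F (0, 0) x = f x) ->
       forall (t : R) (v : 'cV[R]_d),
         F (t, v) = (mu * t, L *m v + t *: (mx_Phi ((mu * t) *: A2) *m v0))).
Proof.
have A1P : A1 *m P = c *: (P *m A2) by rewrite A1E -scalemxAl mulmxKV.
(* If A2 = 0 then A1 = 0 and g1 is abelian. Being nonzero, A2 has rank exactly one in the excluded
   case below. *)
have A2_neq0 : A2 != 0.
  apply: contra_notN nab => /eqP A20 x y; rewrite /= /sd_lbr A1E A20.
  by rewrite mulmx0 mul0mx scaler0 !mul0mx !scaler0 subrr.
split=> [f isof|f mu v0 L isof mu0 uL fE LPA2 F [F_smooth _ FM] dF]; last first.
  apply: (sd_homE (A1 := A1)) => //; first by have [dF0 _] := F_smooth 1; exact: dF0.
  by move=> t v; rewrite dF fE.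
have f_ideal v : (f (0, v)).1 = 0.
  apply/eqP; apply: contra_notT nh2 => fv.
  have [z [phi [A2E A2A2]]] := sd_iso_not_ideal isof fv.
  by rewrite A2E; apply: semidirect_rank1_nilpotent; rewrite -A2E.
have [mu [v0 [L [mu0 uL fE LA1]]]] := sd_iso_form isof f_ideal.
exists mu, v0, L; split=> //.
  apply: (scalerI c0); rewrite scalerA mulrCA mulfV// mulr1.
  have -> : c *: (L *m P *m A2) = L *m A1 *m P by rewrite -!mulmxA A1P scalemxAr.
  by rewrite LA1 -scalemxAl.
move=> nnil.
(* Composing L with P eliminates A2: PL conjugates A1 into a scalar multiple of itself. *)
have PLA1 : (P *m L) *m A1 = (mu / c) *: (A1 *m (P *m L)).
  rewrite -mulmxA LA1 [A1 *m _]mulmxA A1P -scalemxAl scalerA -mulrA mulVf// mulr1.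
  by rewrite -scalemxAr mulmxA.
suff /eqP : `|mu / c| = 1.
  rewrite normrM normfV -(inj_eq (mulIf (_ : `|c| != 0))) ?normr_eq0//.
  by rewrite mul1r divfK ?normr_eq0// eqr_norm2 => /orP[] /eqP ->; [left|right].
apply/eqP; apply: contra_notT nnil => mu_c.
apply: (@semidirect_nilpotent _ _ _ d).
apply: (scaled_conj_nilpotent (Q := P *m L) (a := mu / c)) => //.
- by rewrite unitmx_mul uP.
- by rewrite mulf_neq0// invr_eq0.
(* If a positive power of mu/c equals 1, then |mu/c| is a nonnegative real with a positive power
   equal to 1, hence is 1. *)
move=> k k0; apply: contraNneq mu_c => muk.
by rewrite -(@pexpr_eq1 _ _ k)// -normrX muk normr1.
Qed.
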